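(* Let $n\ge 2$, let $A_1,\dots,A_n$ be bounded self-adjoint operators on a complex Hilbert space $H$, let $\lambda\neq 0$ be an isolated point of $\sigma(A_1)$, let $a_2,\dots,a_n$ be scalars, and suppose that there exists $\rho>0$ such that (as sets, i.e. up to multiplicity) $$\Delta_\rho(1/\lambda,0,\dots,0)\cap\{\lambda x_1+a_2x_2+\dots+a_nx_n=1\}=\Delta_\rho(1/\lambda,0,\dots,0)\cap\sigma_p(A_1,\dots,A_n).$$ Then the following are equivalent: (1) The eigensubspace of $A_1$ corresponding to the eigenvalue $\lambda$ is an eigensubspace for each of the operators $A_2,\dots,A_n$. (2) There exist $\epsilon\in\mathbb{R}$, $\epsilon\neq -1$, and $\rho'>0$ such that $A_1(\epsilon,\lambda)$ is invertible and (as sets, i.e. up to multiplicity) $$\Delta_{\rho'}(\lambda,0,\dots,0)\cap\{(1/\lambda)x_1+a_2x_2+\dots+a_nx_n=1\}=\Delta_{\rho'}(\lambda,0,\dots,0)\cap\sigma_p\bigl(A_1(\epsilon,\lambda)^{-1},A_2(\epsilon,a_2),\dots,A_n(\epsilon,a_n)\bigr).$$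
   Context: For bounded operators $B_1,\dots,B_n$ on $H$, the proper joint spectrum is $\sigma_p(B_1,\dots,B_n)=\{(x_1,\dots,x_n)\in\mathbb{C}^n:\ x_1B_1+\dots+x_nB_n-I \text{ is not invertible on } H\}$. For $x\in\mathbb{C}^n$, $\Delta_\rho(x)$ is the polydisk of radius $\rho$ centered at $x$. For an operator $A$ and scalars $\epsilon,b$, put $A(\epsilon,b)=(1+\epsilon)A-b\,\epsilon I$. A subspace $L\subset H$ is an eigensubspace for an operator $B$ if $B$ acts on $L$ as a scalar multiple of the identity. Sets such as $\{\lambda x_1+a_2x_2+\dots+a_nx_n=1\}$ denote subsets of $\mathbb{C}^n$. *)

(* Defs.v *)
From HB Require Import structures.
From mathcomp Require Import all_boot all_order all_algebra.
From mathcomp Require Import sesquilinear complex.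
From mathcomp Require Import all_classical all_reals all_analysis.
Import Order.TTheory GRing.Theory Num.Theory.
Import numFieldNormedType.Exports.

Set Implicit Arguments.
Unset Strict Implicit.
Unset Printing Implicit Defensive.

Local Open Scope classical_set_scope.
Local Open Scope ring_scope.
Local Open Scope complex_scope.

(* The complex numbers, typed as an abstract field structure: the library
   attaches the norm topology to such structures, not to [complex R]. *)
Definition cplx (R : realType) : numClosedFieldType := R[i].

(* A complex Hilbert space is a complete normed space [H] together with an
   inner product, linear in its first argument, that induces the norm. *)
Definition induces_norm (R : realType) (H : completeNormedModType (cplx R))
    (ip : {dot H for Num.conj}) : Prop :=
  forall u : H, `|u| ^+ 2 = ip u u.

Section Operators.
Context {R : realType} {H : completeNormedModType (cplx R)}.
Local Notation C := (cplx R).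

Definition bounded_op (B : H -> H) : Prop :=
  exists M : R, forall u : H, `|B u| <= M%:C * `|u|.

Definition self_adjoint (ip : {dot H for Num.conj}) (B : H -> H) : Prop :=
  forall u v : H, ip (B u) v = ip u (B v).

(* [S] is a two-sided inverse of [T] in the algebra of bounded operators. *)
Definition op_inverse (T : H -> H) (S : {linear H -> H}) : Prop :=
  [/\ bounded_op S, cancel T S & cancel S T].

Definition op_invertible (T : H -> H) : Prop :=
  exists S : {linear H -> H}, op_inverse T S.

Definition spectrum (T : H -> H) : set C :=
  [set z | ~ op_invertible (fun u => T u - z *: u)].

Definition proper_joint_spectrum n (B : 'I_n -> H -> H) : set ('I_n -> C) :=
  [set x | ~ op_invertible (fun u => \sum_(i < n) x i *: B i u - u)].

Definition eigenspace_of (T : H -> H) (z : C) : set H :=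
  [set u | T u = z *: u].

Definition is_eigensubspace (B : H -> H) (L : set H) : Prop :=
  exists c : C, forall u, L u -> B u = c *: u.

Definition perturb (B : H -> H) (eps b : C) : H -> H :=
  fun u => (1 + eps) *: B u - (b * eps) *: u.

End Operators.

Definition polydisk (R : realType) n (rho : R) (p : 'I_n -> cplx R) :
    set ('I_n -> cplx R) :=
  [set y | forall i, `|y i - p i| < rho%:C].

Definition hyperplane (R : realType) n (c : 'I_n -> cplx R) :
    set ('I_n -> cplx R) :=
  [set y | \sum_(i < n) c i * y i = 1].

(* The tuple [(t, f 0, ..., f (n - 1))]. *)
Definition fcons (T : Type) n (t : T) (f : 'I_n -> T) : 'I_n.+1 -> T :=
  fun i => if unlift ord0 i is Some j then f j else t.

(* Main.v *)
(* Write [A = A_1 - lam] and [V_j = A_j - a_j]. Intersecting the joint spectrum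
   with the lines spanned by [A_1] and one [A_j] turns the hypothesis into: for
   all small real [w] the pencil [A + w V_j] has no spectrum in a fixed punctured
   neighbourhood of 0, and 0 itself is in its spectrum. In particular [lam] and
   the [a_j] are real.

   A self-adjoint [T] with no spectrum in the punctured [r]-neighbourhood of 0
   satisfies [r |<T u, u>| <= |T u|^2], hence also [r |T u| <= |T (T u)|]. The
   second inequality yields the orthogonal projection [P] onto [ker A], with
   [A + P] invertible.

   If every [A_j] is scalar on [ker A], the first inequality for [A + w V_j] at
   [u] in [ker A] gives [V_j P = 0] as [w -> 0]; the joint spectrum of the
   perturbed tuple then splits along [P], and a small [1 + eps] works.

   Conversely, the same inequality at [u + w v] with [u] in [ker A] and
   [A v = - V_j u] shows [<A v, v> = 0]: the second-order perturbation
   coefficient vanishes. The second tuple gives the analogous equality, and the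
   two together force [A v = 0], i.e. [V_j u = 0]. *)
Require Import Defs.
From HB Require Import structures.
From mathcomp Require Import all_boot all_order all_algebra.
From mathcomp Require Import sesquilinear complex.
From mathcomp Require Import all_classical all_reals all_analysis.
From mathcomp Require Import ring lra.
Import Order.TTheory GRing.Theory Num.Theory.
Import numFieldNormedType.Exports.

Set Implicit Arguments.
Unset Strict Implicit.
Unset Printing Implicit Defensive.

Local Open Scope classical_set_scope.
Local Open Scope ring_scope.
Local Open Scope complex_scope.

(** * The real inner product, squared norms and completeness *)

Section HilbertSpace.
Context {R : realType} {H : completeNormedModType (cplx R)}.
Context (ip : {dot H for Num.conj}) (hip : induces_norm ip).
Local Notation C := (cplx R).
Implicit Types (u v x : H) (t : R) (z : C).

(** Working with the real part keeps every estimate in [R], within reach of linear arithmetic. For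
    complex-linear operators, symmetry with respect to [rip] is all that the later arguments use of
    self-adjointness. *)
Definition rip u v : R := complex.Re (ip u v).
Definition sqn u : R := rip u u.

Lemma ipDl u v x : ip (u + v) x = ip u x + ip v x.
Proof. by rewrite linearDl. Qed.
Lemma ipDr x u v : ip x (u + v) = ip x u + ip x v.
Proof. by rewrite linearDr. Qed.
Lemma ipNl u x : ip (- u) x = - ip u x.
Proof. by rewrite linearNl. Qed.
Lemma ipNr x u : ip x (- u) = - ip x u.
Proof. by rewrite linearNr. Qed.
Lemma ipZl z u x : ip (z *: u) x = z * ip u x.
Proof. by rewrite linearZl_LR. Qed.
Lemma ipZr z u x : ip x (z *: u) = z^* * ip x u.
Proof. by rewrite linearZr_LR. Qed.
Lemma ip0l x : ip 0 x = 0.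
Proof. by rewrite linear0l. Qed.
Lemma ipC u v : ip u v = (ip v u)^*.
Proof. by rewrite hermC /= expr0 mul1r. Qed.

Lemma ip_ext u v : (forall x, ip u x = ip v x) -> u = v.
Proof.
move=> e; apply/eqP; rewrite -subr_eq0 -(dnorm_eq0 ip).
by rewrite {1}/GRing.add ipDl ipNl e subrr.
Qed.

Lemma ripDl u v x : rip (u + v) x = rip u x + rip v x.
Proof. by rewrite /rip ipDl; case: (ip u x); case: (ip v x). Qed.
Lemma ripDr x u v : rip x (u + v) = rip x u + rip x v.
Proof. by rewrite /rip ipDr; case: (ip x u); case: (ip x v). Qed.
Lemma ripNl u x : rip (- u) x = - rip u x.
Proof. by rewrite /rip ipNl; case: (ip u x). Qed.
Lemma ripNr x u : rip x (- u) = - rip x u.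
Proof. by rewrite /rip ipNr; case: (ip x u). Qed.
Lemma ripZl t u x : rip (t%:C *: u) x = t * rip u x.
Proof. by rewrite /rip ipZl; case: (ip u x) => a b /=; rewrite mul0r subr0. Qed.
Lemma ripZr t u x : rip x (t%:C *: u) = t * rip x u.
Proof.
by rewrite /rip ipZr; case: (ip x u) => a b /=; rewrite oppr0 mul0r subr0.
Qed.
Lemma ripC u v : rip u v = rip v u.
Proof. by rewrite /rip ipC; case: (ip v u). Qed.
Lemma rip0l x : rip 0 x = 0.
Proof. by rewrite /rip ip0l. Qed.
Lemma rip0r x : rip x 0 = 0.
Proof. by rewrite ripC rip0l. Qed.
Definition ripE := (ripDl, ripDr, ripNl, ripNr, ripZl, ripZr).

Lemma ripJ z u v : rip (z *: u) v = rip u (z^* *: v).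
Proof.
by rewrite /rip ipZl ipZr; case: z => a b; case: (ip u v) => c d /=; rewrite ?opprK.
Qed.

Lemma ip_sqn u : ip u u = (sqn u)%:C.
Proof.
have := dnorm_ge0 ip u; rewrite /sqn /rip.
by case: (ip u u) => a b; rewrite lecE /= => /andP[/eqP -> _].
Qed.

Lemma sqn_ge0 u : 0 <= sqn u.
Proof. by have := dnorm_ge0 ip u; rewrite ip_sqn ler0c. Qed.

Lemma sqn_eq0 u : sqn u = 0 -> u = 0.
Proof. by move=> e; apply/eqP; rewrite -(dnorm_eq0 ip) ip_sqn e. Qed.

Lemma sqn0 : sqn 0 = 0.
Proof. exact: rip0l. Qed.

(** The squared modulus of [z], valued in [R] rather than in [C]. *)
Definition sqc z : R := complex.Re z ^+ 2 + complex.Im z ^+ 2.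

Lemma sqc_ge0 z : 0 <= sqc z.
Proof. by rewrite addr_ge0 ?sqr_ge0. Qed.

Lemma sqnZ z u : sqn (z *: u) = sqc z * sqn u.
Proof.
rewrite /sqn /rip ipZl ipZr mulrA ip_sqn /sqc; case: z => a b /=.
by rewrite !mulr0 !subr0; ring.
Qed.

Lemma sqnZr t u : sqn (t%:C *: u) = t ^+ 2 * sqn u.
Proof. by rewrite sqnZ /sqc /= expr0n addr0. Qed.

Lemma sqnN u : sqn (- u) = sqn u.
Proof. by rewrite /sqn !ripE opprK. Qed.

Lemma sqnD u v : sqn (u + v) = sqn u + 2 * rip u v + sqn v.
Proof. by rewrite /sqn !ripE (ripC v u); ring. Qed.

Lemma sqnD_le u v : sqn (u + v) <= 2 * sqn u + 2 * sqn v.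
Proof.
have := sqn_ge0 (u - v); rewrite !sqnD sqnN ripNr; lra.
Qed.

Lemma sqnB_le u v : sqn (u - v) <= 2 * sqn u + 2 * sqn v.
Proof. by have := sqnD_le u (- v); rewrite sqnN. Qed.

Lemma norm_sqn u : `|u| = (Num.sqrt (sqn u))%:C.
Proof.
apply/eqP; rewrite -(@eqrXn2 _ 2) ?normr_ge0 //; last first.
  by rewrite ler0c sqrtr_ge0.
by rewrite hip ip_sqn -rmorphXn /= sqr_sqrtr ?sqn_ge0.
Qed.

(** The norms of the increments decay geometrically with ratio [Num.sqrt q], so the sequence is
    Cauchy. The conclusion controls two consecutive terms because that is what passing to the limit
    in a recursion requires. *)
Lemma geometric_complete (w : nat -> H) (K q : R) : 0 <= q < 1 ->
  (forall k, sqn (w k.+1 - w k) <= K * q ^+ k) ->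
  exists l, forall e : R, 0 < e -> exists N, sqn (w N - l) < e /\
    sqn (w N.+1 - l) < e.
Proof.
move=> /andP[q0 q1] wK.
have K0 : 0 <= K by have := le_trans (sqn_ge0 _) (wK 0%N); rewrite mulr1.
pose p := Num.sqrt q; pose L := Num.sqrt K.
have p0 : 0 <= p by exact: sqrtr_ge0.
have p1 : p < 1 by rewrite /p -sqrtr1 ltr_sqrt.
have L0 : 0 <= L by exact: sqrtr_ge0.
have p1' : 0 < 1 - p by rewrite subr_gt0.
have pX k : Num.sqrt (q ^+ k) = p ^+ k.
  elim: k => [|k ih]; first by rewrite !expr0 sqrtr1.
  by rewrite !exprS sqrtrM // ih.
have wL k : `|w k.+1 - w k| <= (L * p ^+ k)%:C.
  by rewrite norm_sqn lecR (le_trans (ler_wsqrtr (wK k))) // sqrtrM // pX.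
(* The right-hand side is the exact sum of the bounds [L * p ^+ k] for [k] from [n] to [n + m - 1],
   so the last step of the induction is an identity. *)
have wnm n m : `|w n - w (n + m)%N| <= (L * p ^+ n / (1 - p) * (1 - p ^+ m))%:C.
  elim: m => [|m ih]; first by rewrite addn0 subrr normr0 subrr mulr0.
  have -> : w n - w (n + m.+1)%N = w n - w (n + m)%N - (w (n + m.+1)%N - w (n + m)%N).
    by rewrite opprB addrA subrK.
  apply: le_trans (ler_normB _ _) _; apply: le_trans (lerD ih (_ : _ <= _)) _.
    by rewrite addnS; exact: wL.
  rewrite -rmorphD lecR exprD exprS le_eqVlt; apply/orP; left; apply/eqP.
  by field; rewrite gt_eqF.
have small (e : R) : 0 < e -> exists N, L * p ^+ N / (1 - p) < e.
  move=> e0; have e1 : 0 < e * (1 - p) / (L + 1).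
    by rewrite divr_gt0 ?mulr_gt0 // ltr_wpDl.
  have /cvgrPdist_lt /(_ _ e1) [N _ /(_ N (leqnn N))] : p ^+ n @[n --> \oo] --> (0 : R).
    by apply: cvg_expr; rewrite ger0_norm.
  rewrite /= sub0r normrN ger0_norm ?exprn_ge0 // => lt_p; exists N.
  rewrite ltr_pdivrMr //; move: lt_p; rewrite ltr_pdivlMr ?ltr_wpDl //.
  by apply: le_lt_trans; rewrite mulrC ler_wpM2l ?exprn_ge0 // lerDl.
have tail (e : R) : 0 < e -> exists N, forall n, (N <= n)%N -> `|w N - w n| < e%:C.
  move=> /small[N ltN]; exists N => n leNn; rewrite -(subnKC leNn).
  apply: le_lt_trans (wnm _ _) _; rewrite ltcR; apply: le_lt_trans ltN.
  rewrite ler_piMr ?gerBl ?exprn_ge0 //.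
  by rewrite mulr_ge0 ?invr_ge0 ?mulr_ge0 ?exprn_ge0 // ltW.
have /cauchy_cvgP/cvg_ex[l wl] : cauchy (w @ \oo).
  apply: cauchy_exP => e e0.
  have [e' e'0 ->] : exists2 e' : R, 0 < e' & e = e'%:C.
    by move: e0; case: e => a b; rewrite ltcE /= => /andP[/eqP -> a0]; exists a.
  have [N tailN] := tail _ e'0; exists (w N); exists N => // n /= leNn.
  by rewrite -ball_normE /=; exact: tailN.
exists l => e e0.
have e0' : (0 : C) < (Num.sqrt e)%:C by rewrite ltcR sqrtr_gt0.
move/cvgrPdist_lt: wl => /(_ _ e0')[N _ Nl].
have near_l n : (N <= n)%N -> sqn (w n - l) < e.
  by move=> /Nl /=; rewrite distrC norm_sqn ltcR ltr_sqrt.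
by exists N; split; apply: near_l.
Qed.

(** * Bounded operators and invertibility *)

Implicit Types f g T : H -> H.

Definition lin f := forall (z : C) u v, f (z *: u + v) = z *: f u + f v.
(** Stated for bare functions, so that sums and composites need no packed structure; the constant is
    positive so that it can be divided by. *)
Definition bop f := lin f /\ exists M : R, 0 < M /\ forall u, sqn (f u) <= M * sqn u.

Lemma linD f : lin f -> forall u v, f (u + v) = f u + f v.
Proof. by move=> lf u v; rewrite -{1}[u]scale1r lf scale1r. Qed.
Lemma lin0 f : lin f -> f 0 = 0.
Proof. by move=> lf; have := lf (-1) 0 0; rewrite !scaleN1r oppr0 addr0 addNr. Qed.
Lemma linZ f : lin f -> forall z u, f (z *: u) = z *: f u.
Proof. by move=> lf z u; have := lf z u 0; rewrite !addr0 (lin0 lf) addr0. Qed.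
Lemma linN f : lin f -> forall u, f (- u) = - f u.
Proof. by move=> lf u; rewrite -[- u]scaleN1r (linZ lf) scaleN1r. Qed.

Lemma bop_id : bop id.
Proof. by split=> //; exists 1; split=> // u; rewrite mul1r. Qed.

Lemma bop_add f g : bop f -> bop g -> bop (fun u => f u + g u).
Proof.
move=> [lf [M [M0 fM]]] [lg [N [N0 gN]]]; split.
  by move=> z u v; rewrite lf lg scalerDr addrACA.
exists (2 * M + 2 * N); split; first by lra.
move=> u; apply: le_trans (sqnD_le _ _) _.
by have := fM u; have := gN u; lra.
Qed.

Lemma bop_scale z f : bop f -> bop (fun u => z *: f u).
Proof.
move=> [lf [M [M0 fM]]]; split.
  by move=> y u v; rewrite lf scalerDr !scalerA mulrC.
exists ((sqc z + 1) * M); split.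
  by rewrite mulr_gt0 // ltr_wpDl ?sqc_ge0.
move=> u; rewrite sqnZ -mulrA; apply: ler_pM; rewrite ?sqc_ge0 ?sqn_ge0 //.
by rewrite lerDl.
Qed.

Lemma bop_opp f : bop f -> bop (fun u => - f u).
Proof.
by move=> /(bop_scale (-1)); congr bop; apply/funext => u; rewrite scaleN1r.
Qed.

Lemma bop_comp f g : bop f -> bop g -> bop (f \o g).
Proof.
move=> [lf [M [M0 fM]]] [lg [N [N0 gN]]]; split.
  by move=> z u v; rewrite /= lg lf.
exists (M * N); split; first by rewrite mulr_gt0.
move=> u /=; apply: le_trans (fM _) _; rewrite -mulrA.
by rewrite ler_wpM2l // ltW.
Qed.

Lemma bop_zero : bop (fun=> 0).
Proof.
split=> [z u v|]; first by rewrite scaler0 addr0.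
by exists 1; split=> // u; rewrite sqn0 mulr_ge0 // sqn_ge0.
Qed.

Lemma bop_sum n (F : 'I_n -> H -> H) :
  (forall i, bop (F i)) -> bop (fun u => \sum_(i < n) F i u).
Proof.
elim: n F => [|n ih] F bF.
  by move: bop_zero; congr bop; apply/funext => u; rewrite big_ord0.
have := bop_add (bF ord0) (ih (F \o lift ord0) (fun i => bF _)).
by congr bop; apply/funext => u; rewrite big_ord_recl.
Qed.

Lemma bounded_bop (f : {linear H -> H}) : bounded_op f <-> bop f.
Proof.
split=> [[M fM]|[_ [M [M0 fM]]]].
  split; first by move=> z u v; rewrite linearP.
  exists (M ^+ 2 + 1); split; first by rewrite ltr_wpDl ?sqr_ge0.
  move=> u; have := fM u; rewrite !norm_sqn -rmorphM lecR => le_f.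
  rewrite -[sqn (f u)]sqr_sqrtr ?sqn_ge0 // -[sqn u]sqr_sqrtr ?sqn_ge0 //.
  have := @ler_pM _ _ _ _ _ (sqrtr_ge0 _) (sqrtr_ge0 _) le_f le_f.
  rewrite -!expr2 exprMn => /le_trans -> //.
  by rewrite ler_wpM2r ?sqr_ge0 // lerDl.
exists (Num.sqrt M) => u; rewrite !norm_sqn -rmorphM lecR -(sqrtrM _ (ltW M0)).
exact/ler_wsqrtr/fM.
Qed.

Definition inv_op T := exists S, [/\ bop S, cancel T S & cancel S T].

Lemma op_invertibleE T : op_invertible T <-> inv_op T.
Proof.
split=> [[S [/bounded_bop bS TS ST]]|[S [bS TS ST]]]; first by exists S.
pose a := GRing.isLinear.Build C H H _ S bS.1.
pose S' : {linear H -> H} := HB.pack S a.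
by exists S'; split=> //; apply/bounded_bop.
Qed.

Lemma inv_op_ext T T' : T =1 T' -> inv_op T -> inv_op T'.
Proof. by move=> /funext ->. Qed.

Lemma inv_op_scale z T : z != 0 -> lin T -> inv_op T -> inv_op (fun u => z *: T u).
Proof.
move=> z0 lT [S [bS TS ST]]; exists (fun u => z^-1 *: S u); split.
- exact: bop_scale.
- by move=> u /=; rewrite (linZ bS.1) TS scalerK.
- by move=> u /=; rewrite (linZ lT) ST scalerKV.
Qed.

Lemma inv_op_unscale z T : z != 0 -> lin T -> inv_op (fun u => z *: T u) -> inv_op T.
Proof.
move=> z0 lT; have lzT : lin (fun u => z *: T u).
  by move=> y u v; rewrite lT scalerDr !scalerA mulrC.
move=> /(inv_op_scale (invr_neq0 z0) lzT); apply: inv_op_ext => u /=.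
by rewrite scalerK.
Qed.

(** [T \o K] is a right inverse at sight. Injectivity of [T], inherited from [T \o T], makes it a
    left inverse without first proving that [T] and [K] commute. *)
Lemma inv_op_sqr T : bop T -> inv_op (T \o T) -> inv_op T.
Proof.
move=> bT [K [bK TTK KTT]].
have Tinj : injective T.
  by move=> u v e; apply: (can_inj TTK); rewrite /= e.
exists (T \o K); split.
- exact: bop_comp.
- by move=> u /=; apply: Tinj; exact: KTT.
- by move=> u /=; exact: KTT.
Qed.

(** Picard iteration of [T + c] from 0 has increments [iter k T c], which stay in [N], so the
    estimate is needed there only. The fixed point may lie outside [N], which allows [N] to be a
    range not known to be closed. *)
Lemma contraction_fix (N : H -> Prop) T (q : R) c : bop T -> 0 <= q < 1 ->
  (forall u, N u -> N (T u)) -> (forall u, N u -> sqn (T u) <= q * sqn u) ->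
  N c -> exists w, w = T w + c.
Proof.
move=> [lT [M [M0 TM]]] q01 NT Tq Nc; pose w k := iter k (fun v => T v + c) 0.
have dw k : w k.+1 - w k = iter k T c.
  elim: k => [|k ih]; first by rewrite /= (lin0 lT) add0r subr0.
  have ac a b : a + c - (b + c) = a - b by rewrite opprD addrACA subrr addr0.
  by rewrite iterS -ih (linD lT) (linN lT); exact: ac.
have Ndw k : N (iter k T c) by elim: k => //= k; exact: NT.
have dw_le k : sqn (w k.+1 - w k) <= sqn c * q ^+ k.
  rewrite dw; elim: k => [|k ih]; first by rewrite mulr1.
  apply: le_trans (Tq _ (Ndw k)) _; rewrite exprS mulrCA.
  by rewrite ler_wpM2l //; case/andP: q01.
have [l wl] := geometric_complete q01 dw_le; exists l.
apply/eqP; rewrite eq_sym -subr_eq0; apply/eqP/sqn_eq0.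
set s := sqn _; apply/eqP; rewrite eq_le sqn_ge0 andbT leNgt; apply/negP => s0.
(* The defect [T l + c - l] equals [(w n.+1 - l) - T (w n - l)]. With both terms within [e], its
   square norm is below [2 * (M + 1) * e], which is half of [s]. *)
have e0 : 0 < s / (4 * (M + 1)) by rewrite divr_gt0 // mulr_gt0 // ltr_wpDl // ltW.
have [n [wn wSn]] := wl _ e0.
have : s <= 2 * (M * sqn (w n - l)) + 2 * sqn (w n.+1 - l).
  have -> : s = sqn (w n.+1 - l - T (w n - l)).
    have wS : w n.+1 = T (w n) + c by [].
    rewrite /s; congr sqn; apply: ip_ext => x.
    by rewrite wS (linD lT) (linN lT) !(ipDl, ipNl); ring.
  apply: le_trans (sqnB_le _ _) _; rewrite addrC lerD2r ler_wpM2l //.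
have e4 : s = 4 * (M + 1) * (s / (4 * (M + 1))).
  by rewrite mulrC divfK // mulf_neq0 // gt_eqF // ltr_wpDl // ltW.
move: (s / _) e0 e4 wn wSn => e e0 -> wn wSn; nra.
Qed.

Lemma inv_op_bij T c : bop T -> 0 < c -> (forall u, c * sqn u <= sqn (T u)) ->
  (forall u, exists w, T w = u) -> inv_op T.
Proof.
move=> [lT _] c0 Tc /choice[S ST].
have Tinj : injective T.
  move=> u v e; apply/eqP; rewrite -subr_eq0; apply/eqP/sqn_eq0/eqP.
  rewrite eq_le sqn_ge0 andbT -(pmulr_rle0 _ c0); apply: le_trans (Tc _) _.
  by rewrite (linD lT) (linN lT) e subrr sqn0.
exists S; split=> // [|u]; last exact/Tinj/ST.
split; first by move=> z u v; apply: Tinj; rewrite lT !ST.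
exists c^-1; split; first by rewrite invr_gt0.
by move=> u; rewrite mulrC ler_pdivlMr // mulrC -{2}(ST u).
Qed.

(** Surjectivity is a fixed-point problem. For the lower bound, [a] lies strictly between [q] and 1,
    and positivity of [sqn (a *: u - E u)] bounds the cross term by [a * sqn u + sqn (E u) / a]. *)
Lemma neumann_inv E (q : R) : bop E -> 0 <= q < 1 ->
  (forall u, sqn (E u) <= q * sqn u) -> inv_op (fun u => u - E u).
Proof.
move=> bE q01 Eq; have [q0 q1] := andP q01; pose a := (1 + q) / 2.
have a0 : 0 < a by rewrite /a; lra.
have a1 : a < 1 by rewrite /a; lra.
have aq : q < a by rewrite /a; lra.
apply: (@inv_op_bij _ ((1 - a) * (1 - q / a))).
- exact: bop_add bop_id (bop_opp bE).
- by rewrite mulr_gt0 ?subr_gt0 // ltr_pdivrMr // mul1r.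
- move=> u; have := sqn_ge0 (a%:C *: u - E u); have := Eq u.
  rewrite !sqnD !sqnN !sqnZr !ripNr ripZl => Equ h.
  rewrite -subr_ge0 -(pmulr_rge0 _ a0).
  have -> : a * (sqn u + 2 * - rip u (E u) + sqn (E u) - (1 - a) * (1 - q / a) * sqn u)
    = a ^+ 2 * sqn u + 2 * - (a * rip u (E u)) + sqn (E u)
      + (1 - a) * (q * sqn u - sqn (E u)).
    by field; rewrite gt_eqF.
  by rewrite addr_ge0 // ?mulr_ge0 ?subr_ge0 ?(ltW a1).
- move=> u; have [//|||w wE] := @contraction_fix (fun=> True) E q u bE q01.
  + by [].
  + by [].
  + by exists w; rewrite {1}wE addrC addKr.
Qed.

(** The Lax-Milgram argument: for small [t > 0] the operator [1 - t K] is a strict contraction,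
    hence [t K] is invertible. *)
Lemma coercive_inv K (c : R) : bop K -> 0 < c ->
  (forall u, c * sqn u <= rip (K u) u) -> inv_op K.
Proof.
move=> bK c0 Kc; have [lK [M [M0 KM]]] := bK.
(* The bound [t * M <= c] absorbs the quadratic term, and adding [c ^+ 2] ensures [t * c <= 1], so
   the factor [1 - t * c] is nonnegative. *)
pose M' := M + c ^+ 2; have M'0 : 0 < M' by rewrite ltr_wpDr ?sqr_ge0.
pose t := c / M'; have t0 : 0 < t by rewrite divr_gt0.
have tM : t * M' = c by rewrite divfK // gt_eqF.
apply: (@inv_op_unscale t%:C) => //; first by rewrite (inj_eq (@complexI R)) gt_eqF.
have : inv_op (fun u => u - (u - t%:C *: K u)).
  apply: (@neumann_inv _ (1 - t * c)).
  - exact: bop_add bop_id (bop_opp (bop_scale _ bK)).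
  - rewrite ltrBlDr ltrDl mulr_gt0 // andbT subr_ge0 -(ler_pM2r M'0) mul1r.
    by rewrite mulrAC tM /M' -expr2 ler_wpDl // ltW.
  - move=> u; rewrite sqnD sqnN ripNr sqnZr ripZr (ripC u).
    have := KM u; have := Kc u; have := sqn_ge0 u => u0 Kcu KMu.
    have : t ^+ 2 * sqn (K u) <= t * c * sqn u.
      rewrite -tM mulrA -expr2 -mulrA ler_wpM2l ?sqr_ge0 //.
      apply: le_trans KMu _; rewrite ler_wpM2r // /M' lerDl sqr_ge0 //.
    have : t * (c * sqn u) <= t * rip (K u) u by rewrite ler_wpM2l // ltW.
    by rewrite mulrBl mul1r -!mulrA => *; lra.
by apply: inv_op_ext => u; rewrite opprB addrC subrK.
Qed.

Definition rsa T := forall u v, rip (T u) v = rip u (T v).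

(** The operator [T \o T] is coercive, since [rip (T (T u)) u = sqn (T u)]. *)
Lemma sa_bounded_below_inv T (c : R) : bop T -> rsa T -> 0 < c ->
  (forall u, c * sqn u <= sqn (T u)) -> inv_op T.
Proof.
move=> bT saT c0 Tc; apply: inv_op_sqr => //.
by apply: (@coercive_inv _ c) => // [|u]; [exact: bop_comp | rewrite /= saT].
Qed.

Lemma inv_op_below T : inv_op T -> exists c : R, 0 < c /\ forall u, c * sqn u <= sqn (T u).
Proof.
move=> [S [[_ [M [M0 SM]]] TS _]]; exists M^-1; rewrite invr_gt0; split=> // u.
by rewrite mulrC ler_pdivrMr // mulrC -{1}(TS u).
Qed.

(** Write [z = x + iy]. Multiplication by [iy] is skew for [rip] and commutes with [T], so after
    this multiplication the self-adjoint part [T - x] contributes nothing to the quadratic form and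
    [y ^+ 2 * sqn u] remains. *)
Lemma nonreal_inv T z : bop T -> rsa T -> complex.Im z != 0 ->
  inv_op (fun u => T u - z *: u).
Proof.
case: z => x y bT saT /= y0; have lT := bT.1.
have bTz : bop (fun u => T u - (x +i* y) *: u).
  exact: bop_add (bop_opp (bop_scale _ bop_id)).
apply: (@inv_op_unscale (0 +i* y)); [|exact: bTz.1|].
  by rewrite eq_complex /= negb_and y0 orbT.
apply: (@coercive_inv _ (y ^+ 2)).
- exact: bop_scale.
- by rewrite exprn_even_gt0.
have rJ u v : rip ((0 +i* y) *: u) v = - rip u ((0 +i* y) *: v).
  rewrite ripJ -ripNr -scaleNr; congr (rip _ (_ *: _)).
  by apply/eqP; rewrite eq_complex /= oppr0 !eqxx.
have J0 u : rip ((0 +i* y) *: u) u = 0.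
  by have := rJ u u; rewrite [X in _ = - X]ripC; lra.
move=> u.
have -> : (0 +i* y) *: (T u - (x +i* y) *: u) =
    (0 +i* y) *: T u - x%:C *: ((0 +i* y) *: u) + (y ^+ 2)%:C *: u.
  apply: ip_ext => v; rewrite !(ipDl, ipNl, ipZl); case: (ip (T u) v) => a b.
  case: (ip u v) => c d; apply/eqP; rewrite eq_complex /=.
  by apply/andP; split; apply/eqP; ring.
have JT0 : rip ((0 +i* y) *: T u) u = 0.
  have : rip (T u) ((0 +i* y) *: u) = rip ((0 +i* y) *: T u) u.
    by rewrite saT (linZ lT) ripC.
  by have := rJ (T u) u; lra.
by rewrite !ripE JT0 J0 mulr0 subr0 add0r.
Qed.

Lemma sa_shift T (x : R) : bop T -> rsa T ->
  bop (fun u => T u - x%:C *: u) /\ rsa (fun u => T u - x%:C *: u).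
Proof.
move=> bT saT; split; first exact: bop_add (bop_opp (bop_scale _ bop_id)).
by move=> u v; rewrite !ripE saT.
Qed.

(** * Spectral gaps of self-adjoint operators *)

(* If [s] is the largest number with [s * sqn u <= sqn (T u)], then the form
   [sqn (T u) - s * sqn u] is positive and Cauchy-Schwarz bounds it below by a
   multiple of [sqn (T (T u) - s *: u)]; invertibility of [T - sqrt s] and
   [T + sqrt s] would then contradict maximality. *)
Lemma sa_gap T (d : R) : bop T -> rsa T -> 0 < d ->
  (forall x : R, `|x| < d -> inv_op (fun u => T u - x%:C *: u)) ->
  forall u, d ^+ 2 * sqn u <= sqn (T u).
Proof.
move=> bT saT d0 Tinv; have [lT [M [M0 TM]]] := bT.
pose E := [set s : R | 0 <= s /\ forall u, s * sqn u <= sqn (T u)].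
suff [s [Es ds]] : exists s, E s /\ d ^+ 2 <= s.
  by move=> u; apply: le_trans (Es.2 u); rewrite ler_wpM2r ?sqn_ge0.
apply: contrapT => noE.
have E0 : E 0 by split=> // u; rewrite mul0r sqn_ge0.
have ubE s : E s -> s <= d ^+ 2.
  by move=> Es; rewrite leNgt; apply/negP => ds; apply: noE; exists s; rewrite ltW.
have supE : has_sup E by split; [exists 0 | exists (d ^+ 2)].
pose s := sup E.
have s0 : 0 <= s by exact: ub_le_sup supE.2 _ E0.
have Es : E s.
  split=> // u; have [u0|u0] := eqVneq (sqn u) 0; first by rewrite u0 mulr0 sqn_ge0.
  have {}u0 : 0 < sqn u by rewrite lt_def u0 sqn_ge0.
  rewrite -ler_pdivlMr //; apply: ge_sup; first exact: supE.1.
  by move=> x [_ Ex]; rewrite ler_pdivlMr.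
have sd : s < d ^+ 2.
  by rewrite ltNge; apply/negP => ds; apply: noE; exists s.
pose m := Num.sqrt s; have m0 : 0 <= m by exact: sqrtr_ge0.
have mm : m ^+ 2 = s by rewrite sqr_sqrtr.
have md : m < d by rewrite -(@ltr_pXn2r _ 2) ?nnegrE ?mm // ltW.
have [|c1 [c10 Tc1]] := inv_op_below (Tinv m _); first by rewrite ger0_norm.
have [|c2 [c20 Tc2]] := inv_op_below (Tinv (- m) _).
  by rewrite normrN ger0_norm.
have Ms : E (s + c1 * c2 / M).
  have c0 : 0 <= c1 * c2 / M by rewrite divr_ge0 ?mulr_ge0 // ltW.
  split; first by rewrite addr_ge0.
  move=> u; pose v := T (T u) - s%:C *: u.
  have vu : c1 * c2 * sqn u <= sqn v.
    have -> : v = T (T u - (- m)%:C *: u) - m%:C *: (T u - (- m)%:C *: u).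
      rewrite /v -mm; apply: ip_ext => x.
      rewrite (linD lT) (linN lT) (linZ lT) !(ipDl, ipNl, ipZl) !rmorphN rmorphXn /=.
      by ring.
    apply: le_trans (Tc1 _); rewrite -mulrA.
    exact: ler_wpM2l (ltW c10) _ _ (Tc2 _).
  (* This is the Cauchy-Schwarz step: since [rip (T u) (T v) - s * rip u v = sqn v], positivity of
     the form at [u - M^-1 v] yields [sqn (T u) - s * sqn u >= M^-1 * sqn v]. *)
  have : 0 <= sqn (T (u - M^-1%:C *: v)) - s * sqn (u - M^-1%:C *: v).
    by rewrite subr_ge0; exact: Es.2.
  rewrite (linD lT) (linN lT) (linZ lT) !sqnD !sqnN !sqnZr !ripNr !ripZr.
  have -> : rip (T u) (T v) = sqn v + s * rip u v.
    have -> : sqn v = rip (T (T u)) v - s * rip u v by rewrite /sqn {1}/v !ripE; ring.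
    by rewrite subrK -saT.
  have s_v : 0 <= s * sqn v by rewrite mulr_ge0 ?sqn_ge0.
  have Tv := TM v; move=> h.
  have {Tv} Tv : M^-1 ^+ 2 * sqn (T v) <= M^-1 * sqn v.
    rewrite expr2 -mulrA ler_wpM2l ?invr_ge0 ?(ltW M0) //.
    by rewrite mulrC ler_pdivrMr // mulrC.
  have {s_v} s_v : 0 <= M^-1 ^+ 2 * (s * sqn v) by rewrite mulr_ge0 ?sqr_ge0.
  have : c1 * c2 / M * sqn u <= M^-1 * sqn v.
    by rewrite mulrAC mulrC ler_wpM2l ?invr_ge0 ?(ltW M0).
  by rewrite mulrDl; move: h Tv s_v; lra.
have := ub_le_sup supE.2 Ms; rewrite -/s gerDl leNgt divr_gt0 //.
by rewrite mulr_gt0.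
Qed.

Definition punctured_inv T (r : R) := forall t : R, t != 0 -> `|t| < r ->
  inv_op (fun u => T u - t%:C *: u).

(** The open intervals of radius [r / 2] around [r / 2] and [- r / 2] avoid 0 and stay within radius
    [r]. The gap estimate for [T - t] with [t] one of these centres, once expanded, loses its
    [sqn u] terms. *)
Lemma punctured_form T (r : R) : bop T -> rsa T -> 0 < r -> punctured_inv T r ->
  forall u, r * `|rip (T u) u| <= sqn (T u).
Proof.
move=> bT saT r0 Tr u.
have side (t : R) : `|t| = r / 2 -> 2 * t * rip (T u) u <= sqn (T u).
  move=> tr; have t0 : 0 < `|t| by rewrite tr; lra.
  have [bTt saTt] := sa_shift t bT saT.
  have tinv (x : R) : `|x| < `|t| -> inv_op (fun w => T w - t%:C *: w - x%:C *: w).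
    move=> xt; have : inv_op (fun w => T w - (t + x)%:C *: w).
      apply: Tr; first by rewrite addr_eq0; apply: contraTneq xt => ->; rewrite normrN ltxx.
      by apply: le_lt_trans (ler_normD _ _) _; move: xt; rewrite tr; lra.
    by apply: inv_op_ext => w; rewrite rmorphD /= scalerDl opprD addrA.
  have := sa_gap bTt saTt t0 tinv u.
  by rewrite sqnD sqnN ripNr ripZr sqnZr real_normK ?num_real //; lra.
have r2 : `|r / 2| = r / 2 by rewrite ger0_norm // divr_ge0 // ltW.
have [p|p] := leP 0 (rip (T u) u).
  by have := side (r / 2) r2; rewrite ger0_norm //; lra.
by have := side (- (r / 2)); rewrite normrN => /(_ r2); rewrite ltr0_norm //; lra.
Qed.

(* [2 A^2 (A^2 - r^2) = A (A - r) (A + r)^2 + A (A + r) (A - r)^2] *)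
Lemma punctured_sqr T (r : R) : bop T -> rsa T -> 0 < r -> punctured_inv T r ->
  forall u, r ^+ 2 * sqn (T u) <= sqn (T (T u)).
Proof.
move=> bT saT r0 Tr u; have form := punctured_form bT saT r0 Tr.
have lT := bT.1.
have form1 v : r * rip (T v) v <= sqn (T v).
  by apply: le_trans (form v); rewrite ler_wpM2l ?ler_norm // ltW.
have form2 v : - (r * rip (T v) v) <= sqn (T v).
  apply: le_trans (form v); rewrite -mulrN ler_wpM2l ?(ltW r0) //.
  by rewrite -normrN ler_norm.
have := form1 (T u + r%:C *: u); have := form2 (T u - r%:C *: u).
rewrite !(linD lT) !(linN lT) !(linZ lT) !sqnD !sqnN !sqnZr !ripE.
rewrite [rip (T (T u)) u]saT -/(sqn (T u)).
set a := sqn (T (T u)); set b := rip (T (T u)) (T u).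
set c := sqn (T u); set e := rip (T u) u => f1 f2.
have : 0 <= 2 * (a - r ^+ 2 * c) by lra.
lra.
Qed.

(* [w |-> w - t *: T (T w) + t *: T u] is a contraction on the range of [T]; its
   fixed point solves [T (T w) = T u], and then [P u = u - T w]. *)
Lemma kernel_projection T (c : R) : bop T -> rsa T -> 0 < c ->
  (forall u, c * sqn (T u) <= sqn (T (T u))) ->
  exists P, [/\ bop P, rsa P, forall u, T (P u) = 0,
    forall u, T u = 0 -> P u = u & forall u, exists w, u = P u + T w].
Proof.
move=> bT saT c0 Tc; have [lT [M [M0 TM]]] := bT.
pose M' := M + c; have M'0 : 0 < M' by rewrite addr_gt0.
have M'n : M' != 0 by rewrite gt_eqF.
pose t := M'^-1; have t0 : 0 < t by rewrite invr_gt0.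
have bE : bop (fun u => u - t%:C *: T (T u)).
  exact: bop_add bop_id (bop_opp (bop_scale _ (bop_comp bT bT))).
have q01 : 0 <= 1 - t * c < 1.
  rewrite ltrBlDr ltrDl mulr_gt0 // andbT subr_ge0 mulrC ler_pdivrMr // mul1r.
  by rewrite lerDr ltW.
have decomp u : exists pw : H * H, u = pw.1 + T pw.2 /\ T pw.1 = 0.
  (* The lower bound on [T] is available on [range T] only, so the contraction is confined to that
     set. *)
  have [|||w wE] := @contraction_fix (range T) _ _ (t%:C *: T u) bE q01.
  - move=> _ [v _ <-]; exists (v - t%:C *: T (T v)) => //.
    by rewrite (linD lT) (linN lT) (linZ lT).
  - move=> _ [v _ <-]; rewrite sqnD sqnN ripNr ripZr -saT -/(sqn _) sqnZr.
    have := Tc v; have := TM (T (T v)); have := sqn_ge0 (T (T v)).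
    set x := sqn (T v); set y := sqn (T (T v)); set z := sqn (T _) => y0 zy xy.
    have : t ^+ 2 * z <= t * y.
      rewrite expr2 -mulrA ler_wpM2l ?(ltW t0) // mulrC ler_pdivrMr // mulrC.
      by apply: le_trans zy _; rewrite ler_wpM2r // lerDl ltW.
    have : t * (c * x) <= t * y by rewrite ler_wpM2l // ltW.
    by rewrite mulrBl mul1r -mulrA; lra.
  - by exists (t%:C *: u) => //; rewrite (linZ lT).
  exists (u - T w, w); rewrite /= subrK; split=> //.
  rewrite (linD lT) (linN lT); apply: (@scalerI _ _ t%:C).
    by rewrite (inj_eq (@complexI R)) gt_eqF.
  apply: ip_ext => x; rewrite ipZl ipDl ipNl scaler0 ip0l.
  have := congr1 (ip^~ x) wE; rewrite /= !(ipDl, ipNl, ipZl) => /eqP.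
  by rewrite -subr_eq0 => /eqP h; rewrite -[RHS]oppr0 -h; ring.
have [F FP] := choice decomp; pose P u := (F u).1.
have TP u : T (P u) = 0 by have [] := FP u.
(* The kernel of a self-adjoint operator is orthogonal to its range, so the decomposition is unique;
   linearity of the chosen [P] follows. *)
have Puniq u p w : u = p + T w -> T p = 0 -> p = P u.
  move=> uE Tp; apply/eqP; rewrite -subr_eq0; apply/eqP/sqn_eq0.
  have e : p - P u = T ((F u).2 - w).
    have [h _] := FP u; rewrite (linD lT) (linN lT); apply: ip_ext => x.
    have := congr1 (ip^~ x) uE; rewrite {1}h /= !(ipDl, ipNl) => /eqP.
    rewrite -subr_eq0 => /eqP h'; apply/eqP; rewrite -subr_eq0.
    by apply/eqP; rewrite -[RHS]oppr0 -h' /P; ring.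
  by rewrite /sqn {2}e -saT (linD lT) (linN lT) Tp TP subr0 rip0l.
exists P; split=> //.
- have lP : lin P.
    move=> z u v; apply/esym.
    apply: (Puniq _ _ (z *: (F u).2 + (F v).2)).
      by rewrite lT addrACA -scalerDr; have [<- _] := FP u; have [<- _] := FP v.
    by rewrite lT !TP scaler0 addr0.
  split=> //; exists 1; split=> // u; rewrite mul1r.
  have [h _] := FP u; rewrite {2}h sqnD -saT TP rip0l mulr0 addr0.
  by rewrite lerDl sqn_ge0.
- move=> u v; have [hu _] := FP u; have [hv _] := FP v.
  have -> : rip (P u) v = rip (P u) (P v).
    by rewrite {1}hv ripDr -saT TP rip0l addr0.
  by rewrite {2}hu ripDl saT TP rip0r addr0.
- by move=> u Tu; apply/esym/(Puniq _ _ 0); rewrite // (lin0 lT) addr0.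
- by move=> u; exists (F u).2; have [] := FP u.
Qed.


(** * Pencils of self-adjoint operators *)

Lemma le_small_eq0 (x K w0 : R) : 0 <= x -> 0 < w0 ->
  (forall w, 0 < w < w0 -> x <= w * K) -> x = 0.
Proof.
move=> x0 w00 xK; apply/eqP; rewrite eq_le x0 andbT leNgt; apply/negP => {}x0.
have K0 : 0 < K.
  have w2 : 0 < w0 / 2 < w0 by apply/andP; split; lra.
  by rewrite -(@pmulr_rgt0 _ (w0 / 2)) ?(lt_le_trans x0 (xK _ w2)); case/andP: w2.
pose w := Num.min (w0 / 2) (x / (2 * K)).
have w_gt0 : 0 < w by rewrite lt_min !divr_gt0 // mulr_gt0.
have w_lt : w < w0 by rewrite gt_min; apply/orP; left; lra.
have := xK w; rewrite w_gt0 w_lt => /(_ isT).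
have : w * K <= x / 2.
  apply: le_trans (_ : x / (2 * K) * K <= _).
    by rewrite ler_pM2r // ge_min lexx orbT.
  by rewrite invfM mulrA mulfVK // gt_eqF.
lra.
Qed.

(** These are the first and second order perturbation coefficients of the eigenvalue 0. At [u] the
    form of the pencil has order [w] against a square norm of order [w ^+ 2]; at [u + w v] the
    orders are [w ^+ 2] against [w ^+ 4]. Letting [w] tend to 0 in [punctured_form] kills the
    leading coefficient. *)
Lemma pencil_vanish A V (r w0 : R) : bop A -> bop V -> rsa A -> rsa V ->
  0 < r -> 0 < w0 ->
  (forall w : R, `|w| < w0 -> punctured_inv (fun u => A u + w%:C *: V u) r) ->
  forall u, A u = 0 ->
    rip (V u) u = 0 /\ forall v, A v = - V u -> rip (A v) v = 0.
Proof.
move=> bA bV saA saV r0 w00 AVr u Au; have lA := bA.1; have lV := bV.1.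
have form (w : R) v : 0 < w < w0 ->
    r * `|rip (A v + w%:C *: V v) v| <= sqn (A v + w%:C *: V v).
  move=> /andP[w_gt0 w_lt]; apply: (@punctured_form (fun v => A v + w%:C *: V v)) => //.
  - exact: bop_add bA (bop_scale _ bV).
  - by move=> x y; rewrite !ripE saA saV.
  - by apply: AVr; rewrite gtr0_norm.
have null (x : R) : r * `|x| = 0 -> x = 0.
  by move=> /eqP; rewrite mulf_eq0 gt_eqF //= normr_eq0 => /eqP.
split=> [|v Av]; apply: null.
- apply: (@le_small_eq0 _ (sqn (V u)) w0) => //; first by rewrite mulr_ge0 // ltW.
  move=> w w0w; have w_gt0 : 0 < w by case/andP: w0w.
  have := form w u w0w; rewrite Au add0r ripZl sqnZr normrM (gtr0_norm w_gt0).
  by rewrite mulrCA expr2 -mulrA ler_pM2l.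
- apply: (@le_small_eq0 _ (r * `|rip (V v) v| + w0 * sqn (V v)) w0) => //.
    by rewrite mulr_ge0 // ltW.
  move=> w w0w; have [w_gt0 w_lt] := andP w0w.
  have := form w (u + w%:C *: v) w0w.
  have -> : A (u + w%:C *: v) + w%:C *: V (u + w%:C *: v) = (w ^+ 2)%:C *: V v.
    rewrite !(linD lA, linD lV, linZ lA, linZ lV) Au Av.
    by apply: ip_ext => x; rewrite !(ipDl, ipNl, ipZl, ip0l) rmorphXn /=; ring.
  rewrite sqnZr ripZl normrM (ger0_norm (sqr_ge0 w)) ripDr ripZr.
  (* Hence, after division by [w ^+ 2], the form at [u + w v] is
     [- rip (A v) v + w * rip (V v) v]. *)
  have -> : rip (V v) u = - rip (A v) v.
    by rewrite saV ripC -[V u]opprK -Av ripNl.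
  rewrite mulrCA -exprM (exprM w 2 2) [(w ^+ 2) ^+ 2]expr2 -[X in _ <= X]mulrA.
  rewrite ler_pM2l ?exprn_gt0 // => h.
  have h1 : `|rip (A v) v| <= `|- rip (A v) v + w * rip (V v) v| + w * `|rip (V v) v|.
    rewrite -normrN -[X in _ + X * _](gtr0_norm w_gt0) -normrM -[X in _ + X]normrN.
    by apply: le_trans (ler_normD _ _); rewrite addrK.
  have h2 : w ^+ 2 * sqn (V v) <= w * (w0 * sqn (V v)).
    by rewrite expr2 -mulrA ler_pM2l // ler_wpM2r ?sqn_ge0 // ltW.
  have : r * `|rip (A v) v| <= r * (`|- rip (A v) v + w * rip (V v) v| + w * `|rip (V v) v|).
    by rewrite ler_pM2l.
  by rewrite mulrDr; lra.
Qed.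

(** Polarization of the first-order statement, applied at [u], [v] and [u + v]. *)
Lemma pencil_kernel_orth A V (r w0 : R) : bop A -> bop V -> rsa A -> rsa V ->
  0 < r -> 0 < w0 ->
  (forall w : R, `|w| < w0 -> punctured_inv (fun u => A u + w%:C *: V u) r) ->
  forall u v, A u = 0 -> A v = 0 -> rip (V u) v = 0.
Proof.
move=> bA bV saA saV r0 w00 AVr u v Au Av.
have van := pencil_vanish bA bV saA saV r0 w00 AVr.
have [h1 _] := van _ Au; have [h2 _] := van _ Av.
have [|h3 _] := van (u + v); first by rewrite (linD bA.1) Au Av addr0.
by move: h3; rewrite (linD bV.1) !ripE h1 h2 (saV v) (ripC v); lra.
Qed.

(** * The joint spectrum near a coordinate axis *)

(** The modulus valued in [R]; [nmcE] links it to the norm of [C], whose values lie in [C]. *)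
Definition nmc z : R := Num.sqrt (sqc z).

Lemma nmcE z : `|z| = (nmc z)%:C.
Proof. exact: normc_def. Qed.

Lemma nmc_ge0 z : 0 <= nmc z. Proof. exact: sqrtr_ge0. Qed.
Lemma nmc_gt0 z : z != 0 -> 0 < nmc z.
Proof. by rewrite -normr_gt0 nmcE ltcR. Qed.
Lemma nmcD z y : nmc (z + y) <= nmc z + nmc y.
Proof. by have := ler_normD z y; rewrite !nmcE -rmorphD lecR. Qed.
Lemma nmcM z y : nmc (z * y) = nmc z * nmc y.
Proof. by have := normrM z y; rewrite !nmcE -rmorphM => /complexI. Qed.
Lemma nmcV z : nmc z^-1 = (nmc z)^-1.
Proof. by have := normfV z; rewrite !nmcE -fmorphV => /complexI. Qed.
Lemma nmcN z : nmc (- z) = nmc z.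
Proof. by have := normrN z; rewrite !nmcE => /complexI. Qed.
Lemma nmcR (x : R) : nmc x%:C = `|x|.
Proof. by rewrite /nmc /sqc /= expr0n addr0 sqrtr_sqr. Qed.

Lemma fcons0 (X : Type) n (x : X) (f : 'I_n -> X) : fcons x f ord0 = x.
Proof. by rewrite /fcons unlift_none. Qed.
Lemma fconsS (X : Type) n (x : X) (f : 'I_n -> X) j : fcons x f (lift ord0 j) = f j.
Proof. by rewrite /fcons liftK. Qed.

(** With [mu = c + b j * w + t], the test point has first coordinate [1 / mu], coordinate [w / mu]
    at [j], and 0 elsewhere. There the joint operator is [mu^-1] times the displayed one, and the
    hyperplane equation says [c + b j * w = mu], that is, [t = 0]. *)
Lemma line_inv n (B : 'I_n.+2 -> H -> H) (c : C) (b : 'I_n.+1 -> C) (rho : R) :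
  c != 0 -> 0 < rho -> (forall i, bop (B i)) ->
  polydisk rho (fcons c^-1 (fun=> 0)) `&` hyperplane (fcons c b) =
  polydisk rho (fcons c^-1 (fun=> 0)) `&` proper_joint_spectrum B ->
  exists r w0 : R, [/\ 0 < r, 0 < w0 & forall j (w : R) (t : C),
    `|w| < w0 -> nmc t < r ->
    t = 0 <-> ~ inv_op (fun u => B ord0 u + w%:C *: B (lift ord0 j) u
                                 - (c + b j * w%:C + t) *: u)].
Proof.
move=> c0 rho0 bB eqB; pose k := nmc c; have k0 : 0 < k by exact: nmc_gt0.
pose beta := \sum_j nmc (b j).
have beta0 : 0 <= beta by apply: sumr_ge0 => j _; exact: nmc_ge0.
(* The bound [k / 4] keeps [nmc mu] above [k / 2], and [rho * k ^+ 2 / 4] puts [mu^-1] within [rho]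
   of [c^-1]. In [w0], the first bound gives [nmc (b j * w) <= r] for all [j] at once, and the
   second puts [w / mu] within [rho] of 0. *)
pose r := Num.min (k / 4) (rho * k ^+ 2 / 4).
have r0 : 0 < r by rewrite lt_min !divr_gt0 ?mulr_gt0 ?exprn_gt0.
pose w0 := Num.min (r / (beta + 1)) (rho * k / 2).
have w00 : 0 < w0 by rewrite lt_min !divr_gt0 ?mulr_gt0 // ltr_wpDl.
exists r, w0; split=> // j w t ww0 tr; pose mu := c + b j * w%:C + t.
rewrite -/mu.
have d2r : nmc (mu - c) < 2 * r.
  have -> : mu - c = b j * w%:C + t by rewrite /mu; ring.
  apply: le_lt_trans (nmcD _ _) _; rewrite nmcM nmcR mulrDl mul1r.
  apply: ler_ltD => //; move: ww0; rewrite lt_min => /andP[].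
  rewrite ltr_pdivlMr ?ltr_wpDl // => h _.
  apply: le_trans (ltW h); rewrite mulrC ler_wpM2l //.
  by rewrite /beta (bigD1 j) //= -addrA lerDl addr_ge0 // sumr_ge0 // => i _; exact: nmc_ge0.
have rk : r <= k / 4 by rewrite ge_min lexx.
have rk2 : r <= rho * k ^+ 2 / 4 by rewrite ge_min lexx orbT.
have mu_k : k / 2 < nmc mu.
  have : k <= nmc mu + nmc (mu - c).
    rewrite -(nmcN (mu - c)); apply: le_trans (nmcD _ _); rewrite /k le_eqVlt.
    by apply/orP; left; apply/eqP; congr nmc; ring.
  by lra.
have mu0 : mu != 0.
  by apply: contraTneq mu_k => ->; rewrite -(rmorph0 (real_complex R)) nmcR normr0 -leNgt; lra.
pose y := fcons mu^-1 (fun i => if i == j then w%:C / mu else 0).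
have y_disk : polydisk rho (fcons c^-1 (fun=> 0)) y.
  move=> i; rewrite /y; case: (unliftP ord0 i) => [i' ->|->]; rewrite ?fconsS ?fcons0 nmcE ltcR.
    case: ifP => _; last by rewrite subr0 -(rmorph0 (real_complex R)) nmcR normr0.
    rewrite subr0 nmcM nmcV nmcR ltr_pdivrMr; last by lra.
    move: ww0; rewrite lt_min => /andP[_ h]; apply: lt_le_trans h _.
    by rewrite -mulrA ler_pM2l // ltW.
  have -> : mu^-1 - c^-1 = (c - mu) / (mu * c) by field; rewrite mu0 c0.
  rewrite nmcM nmcV nmcM -nmcN opprB ltr_pdivrMr; last by rewrite mulr_gt0 //; lra.
  have : k / 2 * k <= nmc mu * k by rewrite ler_pM2r // ltW.
  rewrite -(ler_pM2l rho0) -/k; move: rk2; rewrite expr2; lra.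
have y_plane : hyperplane (fcons c b) y <-> t = 0.
  rewrite /hyperplane /y /= big_ord_recl !fcons0 (bigD1 j) //= !fconsS eqxx.
  rewrite big1 ?addr0; last by move=> i /negPf ij; rewrite !fconsS ij mulr0.
  rewrite mulrA -mulrDl; split=> [h|t0].
    have : c + b j * w%:C = mu by rewrite -[LHS](divfK mu0) h mul1r.
    by rewrite /mu => /eqP; rewrite eq_sym -subr_eq0 addrC addKr => /eqP.
  by have <- : mu = c + b j * w%:C; [rewrite /mu t0 addr0 | rewrite divff].
have y_spec : proper_joint_spectrum B y <-> ~ inv_op (fun u =>
    B ord0 u + w%:C *: B (lift ord0 j) u - mu *: u).
  set T := (X in _ <-> ~ inv_op X); rewrite /proper_joint_spectrum /=.
  have bT : bop T.
    exact: bop_add (bop_add (bB _) (bop_scale _ (bB _))) (bop_opp (bop_scale _ bop_id)).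
  have -> : (fun u => \sum_i y i *: B i u - u) = (fun u => mu^-1 *: T u).
    apply/funext => u; rewrite /y big_ord_recl fcons0 (bigD1 j) //= fconsS eqxx.
    rewrite big1 ?addr0; last by move=> i /negPf ij; rewrite fconsS ij scale0r.
    by rewrite /T !scalerDr scalerN !scalerA mulVf // scale1r [mu^-1 * _]mulrC.
  split=> h; apply: contra_not h; [move=> h|move=> /op_invertibleE h].
    by apply/op_invertibleE; apply: inv_op_scale; rewrite ?invr_eq0 //; exact: bT.1.
  by apply: (inv_op_unscale _ _ h); rewrite ?invr_eq0 //; exact: bT.1.
rewrite -y_plane -y_spec.
split=> h.
  by have [] : (polydisk rho (fcons c^-1 (fun=> 0)) `&` proper_joint_spectrum B) y
    by rewrite -eqB.
by have [] : (polydisk rho (fcons c^-1 (fun=> 0)) `&` hyperplane (fcons c b)) y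
  by rewrite eqB.
Qed.


(** * Stability of invertibility and splitting along a projection *)

Lemma rip_ext u v : (forall x, rip u x = rip v x) -> u = v.
Proof.
move=> e; apply/eqP; rewrite -subr_eq0; apply/eqP/sqn_eq0.
by rewrite {1}/sqn ripDl ripNl e subrr.
Qed.

Lemma lin_sum T n (F : 'I_n -> H) : lin T -> T (\sum_i F i) = \sum_i T (F i).
Proof.
move=> lT; elim: n F => [|n ih] F; first by rewrite !big_ord0 (lin0 lT).
by rewrite !big_ord_recl (linD lT) ih.
Qed.

Lemma inv_op_comp T T' : inv_op T -> inv_op T' -> inv_op (fun u => T (T' u)).
Proof.
move=> [S [bS TS ST]] [S' [bS' TS' ST']]; exists (S' \o S); split.
- exact: bop_comp.
- by move=> u /=; rewrite TS TS'.
- by move=> u /=; rewrite ST' ST.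
Qed.

(** Factor [T + E] as [T (1 + S E)] with [S] the inverse of [T], and make [S E] a contraction. *)
Lemma inv_op_perturb T : bop T -> inv_op T -> exists eta : R, 0 < eta /\
  forall E, bop E -> (forall u, sqn (E u) <= eta * sqn u) ->
    inv_op (fun u => T u + E u).
Proof.
move=> bT invT; have [S [bS TS ST]] := invT; have [lS [M [M0 SM]]] := bS.
exists (M^-1 / 2); split=> [|E bE EM]; first by rewrite divr_gt0 // invr_gt0.
have : inv_op (fun u => T (u - - S (E u))).
  apply: inv_op_comp => //; apply: (@neumann_inv _ (1 / 2)).
  - exact: bop_opp (bop_comp bS bE).
  - by apply/andP; split; lra.
  - move=> u; rewrite sqnN; apply: le_trans (SM _) _.
    have : M * sqn (E u) <= M * (M^-1 / 2 * sqn u) by rewrite ler_pM2l.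
    by rewrite mulrA mulrA divff ?gt_eqF.
by apply: inv_op_ext => u; rewrite opprK (linD bT.1) ST.
Qed.

(** [T] commutes with [P] and is the scalar [k] on its range. Adding [(s - k) P] replaces [k] by [s]
    there and leaves the complement alone, so the inverse changes by [(s^-1 - k^-1) P]. *)
Lemma inv_op_block T P (k s : C) : inv_op T -> lin T -> bop P -> k != 0 -> s != 0 ->
  (forall u, P (P u) = P u) ->
  (forall u, T (P u) = k *: P u) -> (forall u, P (T u) = k *: P u) ->
  inv_op (fun u => T u + (s - k) *: P u).
Proof.
move=> [S [bS TS ST]] lT bP k0 s0 PP TP PT.
have SP u : S (P u) = k^-1 *: P u.
  by rewrite -[in RHS](TS (P u)) TP (linZ bS.1) scalerK.
have PS u : P (S u) = k^-1 *: P u.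
  by rewrite -{2}(ST u) PT scalerK.
exists (fun u => S u + (s^-1 - k^-1) *: P u); split.
- exact: bop_add bS (bop_scale _ bP).
- move=> u; rewrite (linD bS.1) TS (linZ bS.1) SP (linD bP.1) PT (linZ bP.1) PP.
  apply: ip_ext => x; rewrite !(ipDl, ipZl); field; exact/andP.
- move=> u; rewrite (linD lT) ST (linZ lT) TP (linD bP.1) PS (linZ bP.1) PP.
  apply: ip_ext => x; rewrite !(ipDl, ipZl); field; exact/andP.
Qed.

Lemma sum_small n (F : 'I_n -> H -> H) (eta : R) : (forall i, bop (F i)) -> 0 < eta ->
  exists rho : R, 0 < rho /\ forall d : 'I_n -> C, (forall i, nmc (d i) < rho) ->
    forall u, sqn (\sum_i d i *: F i u) <= eta * sqn u.
Proof.
elim: n F eta => [|n ih] F eta bF eta0.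
  by exists 1; split=> // d _ u; rewrite big_ord0 sqn0 mulr_ge0 ?sqn_ge0 // ltW.
have [|rho [rho0 small]] := ih (F \o lift ord0) (eta / 4) (fun i => bF _).
  by rewrite divr_gt0.
have [_ [M [M0 FM]]] := bF ord0.
have x0 : 0 < eta / (4 * M) by rewrite divr_gt0 // mulr_gt0.
exists (Num.min rho (Num.sqrt (eta / (4 * M)))).
rewrite lt_min rho0 sqrtr_gt0 x0; split=> // d d_lt u.
rewrite big_ord_recl; apply: le_trans (sqnD_le _ _) _.
have := small (d \o lift ord0) _ u => /(_ _) /= tail.
have {}tail : sqn (\sum_(i < n) d (lift ord0 i) *: F (lift ord0 i) u) <= eta / 4 * sqn u.
  by apply: tail => i; have := d_lt (lift ord0 i); rewrite lt_min => /andP[].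
have : sqn (d ord0 *: F ord0 u) <= eta / 4 * sqn u.
  have : sqc (d ord0) <= eta / (4 * M).
    have := d_lt ord0; rewrite lt_min => /andP[_].
    by rewrite ltr_sqrt // => /ltW.
  move=> dle; rewrite sqnZ; apply: le_trans (_ : eta / (4 * M) * (M * sqn u) <= _).
    by rewrite ler_pM ?sqc_ge0 ?sqn_ge0.
  rewrite le_eqVlt; apply/orP; left; apply/eqP; field.
  by rewrite gt_eqF.
lra.
Qed.

(** On the range of [P] the joint operator at [y] is the scalar [s = \sum_i b i * y i - 1], which
    vanishes exactly on the hyperplane. Replacing [s] by the fixed nonzero [k] gives an operator
    close to the invertible one at [p]; [inv_op_block] then restores [s] whenever [s] is nonzero. *)
Lemma joint_local n (B : 'I_n.+1 -> H -> H) P (p b : 'I_n.+1 -> C) (k : C) u0 :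
  (forall i, bop (B i)) -> bop P -> (forall u, P (P u) = P u) -> P u0 <> 0 ->
  k != 0 -> \sum_i b i * p i = 1 ->
  (forall i u, B i (P u) = b i *: P u) -> (forall i u, P (B i u) = b i *: P u) ->
  inv_op (fun u => \sum_i p i *: B i u - u + k *: P u) ->
  exists rho : R, 0 < rho /\ forall y, polydisk rho p y ->
    hyperplane b y <-> proper_joint_spectrum B y.
Proof.
move=> bB bP PP Pu0 k0 bp BP PB Ginv; have lP := bP.1.
have bsum (y : 'I_n.+1 -> C) : bop (fun u => \sum_i y i *: B i u - u).
  apply: bop_add (bop_opp bop_id); apply: (@bop_sum _ (fun i u => y i *: B i u)).
  by move=> i; exact: bop_scale.
have [eta [eta0 near_G]] := inv_op_perturb (bop_add (bsum p) (bop_scale _ bP)) Ginv.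
(* Subtracting the scalar part makes the replaced operator at [y] differ from the one at [p] by
   exactly [\sum_i (y i - p i) *: F i u]. *)
pose F i u := B i u - b i *: P u.
have bF i : bop (F i) by exact: bop_add (bB i) (bop_opp (bop_scale _ bP)).
have [rho [rho0 small]] := sum_small bF eta0; exists rho; split=> // y y_disk.
pose T u := \sum_i y i *: B i u - u; pose s := \sum_i b i * y i - 1.
have TP u : T (P u) = s *: P u.
  rewrite /T /s scalerBl scale1r scaler_suml; congr (_ - _).
  by apply: eq_bigr => i _; rewrite BP scalerA mulrC.
have PT u : P (T u) = s *: P u.
  rewrite /T /s (linD lP) (linN lP) (lin_sum _ lP) scalerBl scale1r scaler_suml.
  congr (_ - _); apply: eq_bigr => i _.
  by rewrite (linZ lP) PB scalerA mulrC.
have planeE : hyperplane b y <-> s = 0.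
  rewrite /hyperplane /= /s; split=> [->|/eqP]; first by rewrite subrr.
  by rewrite subr_eq0 => /eqP.
rewrite planeE /proper_joint_spectrum /= -/T; split.
  move=> s0 /op_invertibleE[S [[lS _] TS _]]; apply: Pu0.
  by rewrite -(TS (P u0)) TP s0 scale0r (lin0 lS).
move=> sing; apply: contrapT => /eqP s0; apply/sing/op_invertibleE.
pose T0 u := T u + (k - s) *: P u.
have T0inv : inv_op T0.
  have := near_G (fun u => \sum_i (y i - p i) *: F i u) _ _.
  have -> : (fun u => \sum_i p i *: B i u - u + k *: P u + \sum_i (y i - p i) *: F i u) = T0.
    apply/funext => u; rewrite /T0 /T /F.
    under [X in _ + X]eq_bigr => i _ do rewrite scalerBr scalerBl scalerA.
    rewrite !sumrB -!scaler_suml.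
    have -> : \sum_i (y i - p i) * b i = s.
      rewrite /s -bp -sumrB; apply: eq_bigr => i _; ring.
    by apply: ip_ext => x; rewrite !(ipDl, ipNl, ipZl); ring.
  apply.
    apply: (@bop_sum _ (fun i u => (y i - p i) *: F i u)) => i.
    exact: bop_scale.
  apply: small => i; have := y_disk i; rewrite nmcE ltcR //.
have bT0 : bop T0 by exact: bop_add (bsum y) (bop_scale _ bP).
have T0P u : T0 (P u) = k *: P u.
  by rewrite /T0 TP PP -scalerDl addrC subrK.
have PT0 u : P (T0 u) = k *: P u.
  by rewrite /T0 (linD lP) PT (linZ lP) PP -scalerDl addrC subrK.
have := inv_op_block T0inv bT0.1 bP k0 s0 PP T0P PT0.
apply: inv_op_ext => u; rewrite /T0 -addrA -scalerDl.
by have -> : k - s + (s - k) = 0; [ring | rewrite scale0r addr0].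
Qed.

(** For [u = P u + T w] the vectors [T u = T (T w)] and [P u] are orthogonal, and each controls the
    matching component of [u]. *)
Lemma kernel_shift_inv T P (c : R) : bop T -> rsa T -> bop P -> rsa P -> 0 < c ->
  (forall u, c * sqn (T u) <= sqn (T (T u))) ->
  (forall u, T (P u) = 0) -> (forall u, exists w, u = P u + T w) ->
  inv_op (fun u => T u + P u).
Proof.
move=> bT saT bP saP c0 Tc TP Pdec; pose m := Num.min c 1.
have m0 : 0 < m by rewrite lt_min c0 ltr01.
apply: (@sa_bounded_below_inv _ m) => //; first exact: bop_add.
  by move=> u v; rewrite !ripE saT saP.
move=> u; have [w uE] := Pdec u.
have Tu : T u = T (T w) by rewrite {1}uE (linD bT.1) TP add0r.
have e1 : sqn u = sqn (P u) + sqn (T w).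
  by rewrite {1}uE sqnD -saT TP rip0l mulr0 addr0.
have -> : sqn (T u + P u) = sqn (T (T w)) + sqn (P u).
  by rewrite sqnD saT TP rip0r mulr0 addr0 Tu.
have m1 : m * sqn (P u) <= 1 * sqn (P u).
  by rewrite ler_wpM2r ?sqn_ge0 // ge_min lexx orbT.
have m2 : m * sqn (T w) <= c * sqn (T w).
  by rewrite ler_wpM2r ?sqn_ge0 // ge_min lexx.
by have := Tc w; rewrite e1 mulrDr; lra.
Qed.

(* [A v = - V u] makes [- rip (A v) v] the second-order coefficient of the
   eigenvalue of [A + w V] at [u]. The corresponding vector for the pencil
   [S - l^-1 + w d V] is [- l *: (l *: v + d *: A v)], and the two coefficients
   vanish together only if [A v = 0]. *)
Lemma twin_pencils_vanish A V S (l d r w0 r' w0' : R) : bop A -> bop V -> rsa A -> rsa V ->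
  0 < r -> 0 < w0 -> 0 < r' -> 0 < w0' -> l != 0 -> d != 0 -> bop S ->
  cancel (fun u => l%:C *: u + d%:C *: A u) S -> cancel S (fun u => l%:C *: u + d%:C *: A u) ->
  (forall w : R, `|w| < w0 -> punctured_inv (fun u => A u + w%:C *: V u) r) ->
  (forall w : R, `|w| < w0' ->
     punctured_inv (fun u => S u - l^-1%:C *: u + w%:C *: (d%:C *: V u)) r') ->
  forall u, A u = 0 -> V u = 0.
Proof.
move=> bA bV saA saV r0 w00 r'0 w0'0 l0 d0 bS DS SD AVr SVr u Au.
have lA := bA.1; have lV := bV.1; have lS := bS.1.
have lC0 : l%:C != 0 :> C by rewrite (inj_eq (@complexI R)).
have van := pencil_vanish bA bV saA saV r0 w00 AVr.
have saS : rsa S.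
  by move=> x y; rewrite -{1}(SD y) -{2}(SD x) !ripE saA.
have van' : forall x, S x - l^-1%:C *: x = 0 ->
    rip (d%:C *: V x) x = 0 /\ forall v, S v - l^-1%:C *: v = - (d%:C *: V x) ->
    rip (S v - l^-1%:C *: v) v = 0.
  apply: (@pencil_vanish _ (fun u => d%:C *: V u) r' w0') => //.
  - exact: bop_add bS (bop_opp (bop_scale _ bop_id)).
  - exact: bop_scale.
  - by move=> x y; rewrite !ripE saS.
  - by move=> x y; rewrite !ripE saV.
have Ar : punctured_inv A r.
  have := AVr 0; rewrite normr0 => /(_ w00); congr punctured_inv; apply/funext => x.
  by rewrite scale0r addr0.
have r20 : 0 < r ^+ 2 by rewrite exprn_gt0.
have Asq := punctured_sqr bA saA r0 Ar.
have [P [bP saP AP Pid Pdec]] := kernel_projection bA saA r20 Asq.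
have [G [_ _ GK]] := kernel_shift_inv bA saA bP saP r20 Asq AP Pdec.
have VP := pencil_kernel_orth bA bV saA saV r0 w00 AVr.
have PVu : P (V u) = 0.
  by apply: sqn_eq0; rewrite /sqn saP VP // Pid.
(* Since [V u] is orthogonal to the kernel of [A], inverting [A + P] at [- V u] gives a vector [v]
   with [P v = 0], hence a solution of [A v = - V u]. *)
pose v := G (- V u).
have Gv : A v + P v = - V u by exact: GK.
have Pv : P v = 0.
  apply: rip_ext => x; rewrite rip0l.
  have : rip (A v + P v) (P x) = 0.
    by rewrite Gv ripNl -saP PVu rip0l oppr0.
  by rewrite ripDl saA AP rip0r add0r saP Pid // -saP.
have Av : A v = - V u by rewrite -Gv Pv addr0.
have Avv : rip (A v) v = 0 by exact: (van _ Au).2.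
have Su : S u = l^-1%:C *: u.
  apply: (@scalerI _ _ l%:C) => //; rewrite -(linZ lS) scalerA -rmorphM divff // scale1r.
  by have /= := DS u; rewrite Au scaler0 addr0.
have [|_ /(_ (- l%:C *: (l%:C *: v + d%:C *: A v)))] := van' u.
  by rewrite Su subrr.
have Sv'' : S (- l%:C *: (l%:C *: v + d%:C *: A v))
    - l^-1%:C *: (- l%:C *: (l%:C *: v + d%:C *: A v)) = d%:C *: A v.
  rewrite (linZ lS) DS; apply: ip_ext => x; rewrite !(ipDl, ipNl, ipZl) fmorphV.
  by field.
(* As [rip (A v) v = 0], the vanishing second coefficient reduces to
   [- l * d ^+ 2 * sqn (A v) = 0]. *)
rewrite Sv'' {1}Av scalerN => /(_ erefl).
rewrite -rmorphN !ripE Avv -/(sqn _) mulr0 add0r => /eqP.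
rewrite !mulf_eq0 oppr_eq0 (negPf l0) (negPf d0) /= => /eqP/sqn_eq0.
by rewrite Av => /eqP; rewrite oppr_eq0 => /eqP.
Qed.


(** * From the joint spectrum to real pencils *)

Lemma self_adjoint_rsa T : self_adjoint ip T -> rsa T.
Proof. by move=> sa u v; rewrite /rip sa. Qed.

(** At [t = 0], [line_inv] puts [lam + a j * w] in the spectrum of a self-adjoint operator, so it is
    real for all small real [w]. Taking [w = 0] and then [w = w0 / 2] makes [lam] and each [a j]
    real. *)
Lemma joint_spectrum_pencils n (A : 'I_n.+2 -> H -> H) (lam : C) (a : 'I_n.+1 -> C) (rho : R) :
  (forall i, bop (A i)) -> (forall i, rsa (A i)) -> lam != 0 -> 0 < rho ->
  polydisk rho (fcons lam^-1 (fun=> 0)) `&` hyperplane (fcons lam a) =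
  polydisk rho (fcons lam^-1 (fun=> 0)) `&` proper_joint_spectrum A ->
  exists (l : R) (al : 'I_n.+1 -> R) (r w0 : R),
  [/\ lam = l%:C, forall j, a j = (al j)%:C, 0 < r & 0 < w0] /\
  [/\ ~ inv_op (fun u => A ord0 u - l%:C *: u) &
    forall j (w t : R), `|w| < w0 -> `|t| < r -> t = 0 <->
      ~ inv_op (fun u => A ord0 u - l%:C *: u
         + w%:C *: (A (lift ord0 j) u - (al j)%:C *: u) - t%:C *: u)].
Proof.
move=> bA saA lam0 rho0 /(line_inv lam0 rho0 bA)[r [w0 [r0 w00 line]]].
have nmc0 : nmc 0 = 0 by rewrite -(rmorph0 (real_complex R)) nmcR normr0.
have sing j (w : R) : `|w| < w0 -> ~ inv_op (fun u =>
    A ord0 u + w%:C *: A (lift ord0 j) u - (lam + a j * w%:C) *: u).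
  move=> ww0; have [|h _] := line j w 0 ww0; first by rewrite nmc0.
  by have := h erefl; rewrite addr0.
have im_real j (w : R) : `|w| < w0 -> complex.Im (lam + a j * w%:C) = 0.
  move=> /(sing j) s; apply/eqP; apply: contra_notT s; apply: nonreal_inv.
    exact: bop_add (bA _) (bop_scale _ (bA _)).
  by move=> x y; rewrite !ripE !saA.
have lamE : lam = (complex.Re lam)%:C.
  have := im_real ord0 0; rewrite normr0 => /(_ w00); rewrite mulr0 addr0.
  by case: (lam) => x y /= ->.
have aE j : a j = (complex.Re (a j))%:C.
  have := im_real j (w0 / 2); rewrite gtr0_norm ?divr_gt0 // => /(_ _).
  rewrite lamE; case: (a j) => x y /= h; congr (_ +i* _).
  have {h} : 0 + (x * 0 + y * (w0 / 2)) = 0 by apply: h; lra.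
  rewrite mulr0 !add0r => /eqP; rewrite mulf_eq0 => /orP[/eqP //|].
  by rewrite gt_eqF // divr_gt0.
exists (complex.Re lam), (fun j => complex.Re (a j)), r, w0; split=> //; split.
  have := sing ord0 0; rewrite normr0 => /(_ w00); apply: contra_not.
  by apply: inv_op_ext => u; rewrite mulr0 addr0 scale0r addr0 -lamE.
move=> j w t ww0 tr; have := line j w t%:C ww0; rewrite nmcR => /(_ tr).
have -> : (fun u => A ord0 u + w%:C *: A (lift ord0 j) u - (lam + a j * w%:C + t%:C) *: u) =
    (fun u => A ord0 u - (complex.Re lam)%:C *: u
      + w%:C *: (A (lift ord0 j) u - (complex.Re (a j))%:C *: u) - t%:C *: u).
  apply/funext => u; rewrite -lamE -aE; apply: ip_ext => x.
  by rewrite !(ipDl, ipNl, ipZl); ring.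
move=> <-; split=> [->|/complexI] //.
Qed.

End HilbertSpace.

(* The n >= 2 operators are A ord0 (written A_1 on paper) and
   A (lift ord0 j), j < n.+1 (written A_2, ..., A_n on paper). *)
Theorem theoremA (R : realType) (H : completeNormedModType (cplx R))
    (ip : {dot H for Num.conj}) (hip : induces_norm ip)
    (n : nat) (A : 'I_n.+2 -> {linear H -> H})
    (hbd : forall i, bounded_op (A i))
    (hsa : forall i, self_adjoint ip (A i))
    (lam : cplx R) (hlam0 : lam <> 0)
    (hlam : isolated (spectrum (A ord0)) lam)
    (a : 'I_n.+1 -> cplx R)
    (hrho : exists rho : R, 0 < rho /\
      polydisk rho (fcons lam^-1 (fun=> 0)) `&` hyperplane (fcons lam a) =
      polydisk rho (fcons lam^-1 (fun=> 0)) `&`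
        proper_joint_spectrum (fun i => A i)) :
  (forall j : 'I_n.+1,
     is_eigensubspace (A (lift ord0 j)) (eigenspace_of (A ord0) lam)) <->
  (exists eps : R, eps <> -1 /\
   exists rho' : R, 0 < rho' /\
   exists S : {linear H -> H},
     op_inverse (perturb (A ord0) eps%:C lam) S /\
     polydisk rho' (fcons lam (fun=> 0)) `&` hyperplane (fcons lam^-1 a) =
     polydisk rho' (fcons lam (fun=> 0)) `&`
       proper_joint_spectrum
         (fcons (S : H -> H)
            (fun j : 'I_n.+1 => perturb (A (lift ord0 j)) eps%:C (a j)))).
Proof.
have bA i : bop ip (A i) by apply/bounded_bop.
have saA i : rsa ip (A i) by exact: self_adjoint_rsa.
have /eqP lam0 := hlam0; have [rho [rho0 eqA]] := hrho.
have [l [al [r [w0 [[lamE aE r0 w00] [sing pencil]]]]]] :=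
  joint_spectrum_pencils hip bA saA lam0 rho0 eqA.
pose A' u := A ord0 u - l%:C *: u.
pose V j u := A (lift ord0 j) u - (al j)%:C *: u.
have [bA' saA'] : bop ip A' /\ rsa ip A' by exact: sa_shift.
have bsV j : bop ip (V j) /\ rsa ip (V j) by exact: sa_shift.
have punct j (w : R) : `|w| < w0 ->
    punctured_inv ip (fun u => A' u + w%:C *: V j u) r.
  move=> ww0 t t0 tr; apply: contrapT => /(pencil j w t ww0 tr) t0'.
  by rewrite t0' eqxx in t0.
(* Centred at [lam] and [a j], the perturbation only rescales [A'] and [V j] by [1 + eps]. *)
have perturbA (eps : R) u : perturb (A ord0) eps%:C lam u = l%:C *: u + (1 + eps)%:C *: A' u.
  rewrite /perturb lamE rmorphD rmorph1 /A'; apply: (@ip_ext _ _ ip) => x.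
  by rewrite !(ipDl, ipNl, ipZl); ring.
have perturbV (eps : R) j u : perturb (A (lift ord0 j)) eps%:C (a j) u =
    (al j)%:C *: u + (1 + eps)%:C *: V j u.
  rewrite /perturb aE rmorphD rmorph1 /V; apply: (@ip_ext _ _ ip) => x.
  by rewrite !(ipDl, ipNl, ipZl); ring.
have l0 : l != 0 by apply: contra_neq lam0 => l0; rewrite lamE l0.
have eigenE u : eigenspace_of (A ord0) lam u <-> A' u = 0.
  rewrite /eigenspace_of /= /A' lamE; split=> [->|/eqP]; first by rewrite subrr.
  by rewrite subr_eq0 => /eqP.
have singA' : ~ inv_op ip A' by exact: sing.
have VE j u : V j u = A (lift ord0 j) u - (al j)%:C *: u by [].
clear sing pencil; clearbody A' V.
have A'r : punctured_inv ip A' r.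
  have := punct ord0 0; rewrite normr0 => /(_ w00); congr punctured_inv.
  by apply/funext => u; rewrite scale0r addr0.
have r20 : 0 < r ^+ 2 by rewrite exprn_gt0.
have A'sq := punctured_sqr bA' saA' r0 A'r.
have [P [bP saP A'P Pid Pdec]] := kernel_projection hip bA' saA' r20 A'sq.
have invA'P := kernel_shift_inv hip bA' saA' bP saP r20 A'sq A'P Pdec.
split=> [eig|[eps [eps1 [rho' [rho'0 [S [[bS DS SD] eqS]]]]]]].
(* If [P] were zero, [A' = A' + P] would be invertible, against [singA']. *)
- have [u0 Pu0] : exists u0, P u0 <> 0.
    apply: contrapT => noP; apply: singA'; move: invA'P; apply: inv_op_ext => u.
    by rewrite (contrapT (fun h => noP (ex_intro _ u h))) addr0.
  (* Being scalar on the kernel of [A'], [V j] sends [P u] into that kernel; by [pencil_kernel_orth]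
     the image is also orthogonal to it. *)
  have VP j u : V j (P u) = 0.
    have [c cE] := eig j; have [bV saV] := bsV j.
    have VPE : V j (P u) = (c - (al j)%:C) *: P u.
      by rewrite VE (cE (P u)) ?scalerBl //; apply/eigenE.
    apply: (@sqn_eq0 _ _ ip).
    apply: (pencil_kernel_orth bA' bV saA' saV r0 w00 (punct j)) => //.
    by rewrite VPE (linZ bA'.1) A'P scaler0.
  have lC0 : l%:C != 0 :> cplx R by rewrite -lamE.
  have bl : bop ip (fun u => l%:C *: u) by exact: (bop_scale l%:C (bop_id ip)).
  have [|eta [eta0 near_l]] := inv_op_perturb hip bl.
    apply: (@inv_op_scale _ _ ip _ id) => //.
    by exists id; split=> //; exact: bop_id.
  have [_ [M [M0 A'M]]] := bA'.
  (* With [1 + eps = d], the term [d A'] is small enough for [l + d A'] to remain invertible. *)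
  pose d := Num.sqrt (eta / M); have d0 : 0 < d by rewrite sqrtr_gt0 divr_gt0.
  have dC0 : d%:C != 0 :> cplx R.
    by rewrite (inj_eq (@complexI R)) gt_eqF.
  have d1 : 1 + (d - 1) = d by rewrite addrC subrK.
  have : op_invertible (perturb (A ord0) (d - 1)%:C lam).
    apply/(op_invertibleE hip).
    have := near_l (fun u => d%:C *: A' u) (bop_scale _ bA') _.
    have -> : (fun u => l%:C *: u + d%:C *: A' u) = perturb (A ord0) (d - 1)%:C lam.
      by apply/funext => u; rewrite perturbA d1.
    apply => u; rewrite sqnZr sqr_sqrtr; last by rewrite ltW // divr_gt0.
    by rewrite mulrAC ler_pdivrMr // mulrAC -mulrA ler_pM2l.
  case=> S [/(bounded_bop hip) bS DS SD].
  have DSE u : S (l%:C *: u + d%:C *: A' u) = u by have := DS u; rewrite perturbA d1.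
  have SDE u : l%:C *: S u + d%:C *: A' (S u) = u by have := SD u; rewrite perturbA d1.
  have saS : rsa ip S.
    by move=> x y; rewrite -{1}(SDE y) -{2}(SDE x) !ripE saA'.
  have SP u : S (P u) = lam^-1 *: P u.
    apply: (scalerI lC0); rewrite scalerA lamE divff // scale1r -(linZ bS.1).
    by have := DSE (P u); rewrite A'P scaler0 addr0.
  have rsa_comm B (x : R) : rsa ip B -> (forall u, B (P u) = x%:C *: P u) ->
      forall u, P (B u) = x%:C *: P u.
    move=> saB BP u; apply: (@rip_ext _ _ ip) => v.
    by rewrite saP saB BP ripZr ripZl saP.
  have lamV : lam^-1 = l^-1%:C by rewrite lamE fmorphV.
  pose B := fcons (S : H -> H) (fun j => perturb (A (lift ord0 j)) (d - 1)%:C (a j)).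
  have BPE i u : B i (P u) = fcons lam^-1 a i *: P u.
    case: (unliftP ord0 i) => [j|] ->; rewrite /B ?fconsS ?fcons0 ?SP //.
    by rewrite perturbV VP scaler0 addr0 aE.
  have bB i : bop ip (B i).
    case: (unliftP ord0 i) => [j|] ->; rewrite /B ?fconsS ?fcons0 //.
    by apply: bop_add (bop_opp (bop_scale _ (bop_id ip))); exact: bop_scale.
  have saB i : rsa ip (B i).
    case: (unliftP ord0 i) => [j|] ->; rewrite /B ?fconsS ?fcons0 //.
    by move=> x y; rewrite !perturbV !ripE (bsV j).2.
  have PBE i u : P (B i u) = fcons lam^-1 a i *: P u.
    have [x xE] : exists x : R, fcons lam^-1 a i = x%:C.
      case: (unliftP ord0 i) => [j|] ->; rewrite ?fconsS ?fcons0.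
        by exists (al j); exact: aE.
      by exists l^-1.
    by rewrite xE; apply: rsa_comm => // v; rewrite BPE xE.
  (* The inverse relation gives [lam S - 1 = - d S A'], and [S P = lam^-1 P]. With [k = - d / lam],
     the operator at the centre is therefore [- d S (A' + P)], which is invertible. *)
  have [||||rho' [rho'0 eqS]] := @joint_local _ _ ip hip _ _ P (fcons lam (fun=> 0)) _
    (- (d%:C / lam)) u0 bB bP _ Pu0 _ _ BPE PBE.
  - by move=> u; apply: Pid.
  - by rewrite oppr_eq0 mulf_neq0 ?invr_eq0.
  - rewrite big_ord_recl !fcons0 big1 ?addr0 ?mulVf // => j _.
    by rewrite !fconsS mulr0.
  - have : inv_op ip (fun u => - d%:C *: S (A' u + P u)).
      apply: inv_op_scale; first by rewrite oppr_eq0.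
        by move=> z x y; rewrite bA'.1 bP.1 addrACA -scalerDr bS.1.
      apply: inv_op_comp => //; exists (perturb (A ord0) (d - 1)%:C lam); split=> //.
      by apply: bop_add (bop_opp (bop_scale _ (bop_id ip))); exact: bop_scale.
    apply: inv_op_ext => u; rewrite /B big_ord_recl !fcons0 big1 ?addr0; last first.
      by move=> j _; rewrite fconsS scale0r.
    have := DSE u; rewrite !(linD bS.1) SP !(linZ bS.1) lamE => uE.
    rewrite -{4}uE.
    by apply: (@ip_ext _ _ ip) => x; rewrite !(ipDl, ipNl, ipZl); ring.
  exists (d - 1); split.
    by move=> h; move: dC0; rewrite -d1 h subrr rmorph0 eqxx.
  exists rho'; split=> //; exists S; split.
    by split=> //; apply/(bounded_bop hip).
  by apply/seteqP; split=> y /= [y_disk /(eqS y y_disk)].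
- have d0 : 1 + eps != 0.
    by apply/eqP => h; apply: eps1; apply/eqP; rewrite -subr_eq0 opprK addrC h.
  move/(bounded_bop hip): bS => bS.
  pose B := fcons (S : H -> H) (fun j => perturb (A (lift ord0 j)) eps%:C (a j)).
  have bB i : bop ip (B i).
    case: (unliftP ord0 i) => [j|] ->; rewrite /B ?fconsS ?fcons0 //.
    by apply: bop_add (bop_opp (bop_scale _ (bop_id ip))); exact: bop_scale.
  have lamV0 : lam^-1 != 0 by rewrite invr_eq0.
  (* Here the line argument is run with [c = lam^-1], so the centre [c^-1] is [lam] and the first
     operator is [S]. *)
  have := line_inv hip lamV0 rho'0 bB; rewrite invrK => /(_ _ eqS).
  move=> [r' [w0' [r'0 w0'0 line]]] j.
  exists (al j)%:C => u /eigenE A'u; apply/eqP; rewrite -subr_eq0 -VE; apply/eqP.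
  have [bV saV] := bsV j.
  apply: (twin_pencils_vanish hip bA' bV saA' saV r0 w00 r'0 w0'0 l0 d0 bS
    _ _ (punct j)) => //.
  + by move=> v /=; rewrite -perturbA.
  + by move=> v /=; rewrite -perturbA.
  + move=> w ww0 t t0 tr; apply: contrapT => sing'.
    have := line j w t%:C ww0; rewrite nmcR => /(_ tr)[_ h].
    have t00 : t%:C = 0 :> cplx R.
      apply: h; apply: contra_not sing'; apply: inv_op_ext => v.
      rewrite /B fcons0 fconsS perturbV lamE aE fmorphV.
      by apply: (@ip_ext _ _ ip) => x; rewrite !(ipDl, ipNl, ipZl); ring.
    by move/complexI: t00 => t00; rewrite t00 eqxx in t0.
Qed.
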